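(* Let $A$ be a real finite-dimensional affine space and let $m\in\mathrm{Met}(A)$ be a non-null metric with hessian principal component $g\in S^2\vec A^{*}$. There exists a unique symmetric bilinear form $\mathrm{CM}_m$ on the vector space $\mathrm{Aff}(\mathrm{Quad}_m A)$ such that: 1. $\mathrm{CM}_m(v_1,v_2)=-g(\mathrm d_m v_1,\mathrm d_m v_2)$ for all $v_1,v_2\in \mathrm{Aff}_0(\mathrm{Quad}_m A)$; 2. $\mathrm{CM}_m(v_P,v_P)=0$ for every $P\in A$. Moreover, for a symmetric bilinear form $\mathrm{CM}_m$ on $\mathrm{Aff}(\mathrm{Quad}_m A)$ satisfying (1), condition (2) is equivalent to each of the following: (2'a) for each point $P\in A$, $\mathrm{CM}_m(v_P)=\delta^m_P$; (2'b) for some point $P\in A$, $\mathrm{CM}_m(v_P)=\delta^m_P$; (2''a) for each affine referential $(R_0,\dots,R_n)$ of $A$, the elements $v_{R_i}$ are isotropic (that is, $\mathrm{CM}_m(v_{R_i},v_{R_i})=0$) and $\mathrm{CM}_m(v_{R_i},v_m)=1$, for all $i$; (2''b) for some affine referential $(R_0,\dots,R_n)$ of $A$, all the elements $v_{R_i}$ are isotropic and $\mathrm{CM}_m(v_{R_0},v_m)=1$.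
   Context: All spaces are real and finite-dimensional. For an affine space $A$ with director vector space $\vec A$: $\mathrm{Aff}(A)$ is the vector space of affine functions $A\to\mathbb R$, $u$ the constant function $1$, $\mathbb R=\langle u\rangle\subset\mathrm{Aff}(A)$; $\vec A^{*}=\mathrm{Aff}(A)/\mathbb R$ is the dual of $\vec A$, and $\mathrm df\in\vec A^*$ is the class (linear part) of $f$. The linear hull is $\widehat A=(\mathrm{Aff}(A))^*$; $z_P\in\widehat A$ is evaluation at $P$; $A$ is identified (via $P\mapsto z_P$) with $\{z:\langle z,u\rangle=1\}$ and $\vec A$ with $\{z:\langle z,u\rangle=0\}$, with $\overrightarrow{PQ}=z_Q-z_P$. An affine referential of $A$ ($n=\dim A$) is a sequence of $n+1$ affinely independent points $(R_0,\dots,R_n)$. A function $\delta:A\to\mathbb R$ is quadratic if $\delta(\alpha P+\beta Q)=\alpha(\alpha-\beta)\delta(P)+\beta(\beta-\alpha)\delta(Q)+4\alpha\beta\,\delta(\frac{P+Q}2)$ for all $P,Q\in A$ and $\alpha+\beta=1$; $\mathrm{Quad}(A)$ is the vector space of these. For $\delta\in\mathrm{Quad}(A)$ and $P\in A$ put $\delta^h_P(Q)=\frac12(\delta(Q)+\delta(2P-Q))-\delta(P)$. Then $\delta^h_P(Q)=\frac12\mathrm{Hess}\,\delta(\overrightarrow{PQ},\overrightarrow{PQ})$ for a unique symmetric bilinear form $\mathrm{Hess}\,\delta\in S^2\vec A^*$ on $\vec A$ independent of $P$ (hessian principal component of $\delta$). $\mathrm{Met}(A)=\mathrm{Quad}(A)/\mathrm{Aff}(A)$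 is the space of metrics. For $m\in\mathrm{Met}(A)$, $\mathrm{Quad}_mA\subset\mathrm{Quad}(A)$ is the class $m$, an affine space with director space $\mathrm{Aff}(A)$; its elements all have the same hessian principal component $g$, called the hessian principal component of $m$. $m$ is null if $m=0$ (equivalently $g=0$). $\delta^m_P\in\mathrm{Quad}_mA$ is the function $\delta^m_P(Q)=\frac12g(\overrightarrow{PQ},\overrightarrow{PQ})$. $\mathrm{Aff}(\mathrm{Quad}_mA)$ is the vector space of affine functionals $\mathrm{Quad}_mA\to\mathbb R$; its dual is the linear hull $\widehat{\mathrm{Quad}_mA}$, in which $\mathrm{Quad}_mA$ is embedded by evaluation ($\langle\delta,\bar v\rangle=\bar v(\delta)$). Particular functionals: $v_P(\delta)=\delta(P)$ for $P\in A$, and $v_m(\delta)=1$. The linear map $\mathrm d_m:\mathrm{Aff}(\mathrm{Quad}_mA)\to(\mathrm{Aff}(A))^*=\widehat A$ is $\langle \mathrm d_m\bar v,s\rangle=\bar v(\delta+s)-\bar v(\delta)$ (any $\delta\in\mathrm{Quad}_mA$). $\mathrm{Aff}_0(\mathrm{Quad}_mA)$ is the subspace of $\bar v$ with $\bar v(\delta+\alpha u)=\bar v(\delta)$ for all $\delta\in \mathrm{Quad}_mA$, $\alpha\in\mathbb R$; $\mathrm d_m$ maps it into $\vec A\subset\widehat A$. A bilinear form $\Phi$ on $V$ is also viewed as the linear map $V\to V^*$, $\Phi(v)=\Phi(v,\cdot)$; so in (2'a), (2'b) the equality is in $\widehat{\mathrm{Quad}_mA}=(\mathrm{Aff}(\mathrm{Quad}_mA))^*$.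 *)

(* Defs.v *)
From HB Require Import structures.
From mathcomp Require Import all_boot all_order all_algebra.
From mathcomp Require Import boolp classical_sets functions reals.
From mathcomp Require Import ring lra.

Set Implicit Arguments.
Unset Strict Implicit.
Unset Printing Implicit Defensive.

Import Order.TTheory GRing.Theory Num.Theory.
Local Open Scope ring_scope.

HB.mixin Record isAffineSpace (R : nzRingType) (V : lmodType R) (A : Type) := {
  trans : A -> V -> A;
  vect : A -> A -> V;
  base_point : A;
  trans_trans : forall P x y, trans (trans P x) y = trans P (x + y);
  trans_vect : forall P Q, trans P (vect P Q) = Q;
  vect_trans : forall P x, vect P (trans P x) = x }.

#[short(type="affineType")]
HB.structure Definition AffineSpace (R : nzRingType) (V : lmodType R) :=
  {A of isAffineSpace R V A}.

Section AffineTheory.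
Variables (R : realType) (V : lmodType R) (A : affineType V).
Implicit Types (P Q : A) (x y : V) (f : A -> R^o).

(* $\alpha P + \beta Q$, only meaningful for $\alpha + \beta = 1$: the weight
   [a] is then redundant *)
Definition bary (a b : R) P Q : A := trans P (b *: vect P Q).

Definition midpoint P Q : A := bary 2^-1 2^-1 P Q.

Definition reflect_pt P Q : A := bary 2 (-1) P Q.

Definition is_affine f :=
  exists phi : {scalar V}, forall P x, f (trans P x) = f P + phi x.

Definition is_quadratic f := forall P Q (a b : R), a + b = 1 ->
  f (bary a b P Q) = a * (a - b) * f P + b * (b - a) * f Q
                     + 4 * a * b * f (midpoint P Q).

Lemma trans0 P : trans P 0 = P.
Proof.
have e : vect P P + vect P P = vect P P.
  by rewrite -[LHS](vect_trans P) -trans_trans !trans_vect.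
by move/(canRL (addrK _)): e; rewrite subrr => e; rewrite -{1}e trans_vect.
Qed.

Lemma is_affine_bary f P Q (a b : R) : is_affine f -> a + b = 1 ->
  f (bary a b P Q) = a * f P + b * f Q.
Proof.
move=> [phi fE] ab; rewrite /bary fE linearZ /= -[in RHS](trans_vect P Q) fE.
by have -> : a = 1 - b by [rewrite -ab addrK]; ring.
Qed.

Lemma bary_affine f :
  (forall P Q (a b : R), a + b = 1 -> f (bary a b P Q) = a * f P + b * f Q) ->
  is_affine f.
Proof.
move=> fE; set O : A := base_point.
have fZ P x t : f (trans P (t *: x)) = (1 - t) * f P + t * f (trans P x).
  have := fE P (trans P x) (1 - t) t; rewrite /bary vect_trans => -> //.
  by rewrite subrK.
have phiD P x y : f (trans P (x + y)) = f (trans P x) + f (trans P y) - f P.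
  have -> : trans P (x + y) =
            trans (trans P (2 *: x)) (2^-1 *: (2 *: y - 2 *: x)).
    rewrite trans_trans scalerBr !scalerA mulVf ?pnatr_eq0 // !scale1r.
    by rewrite scaler_nat mulr2n addrCA addrK addrC.
  by rewrite fZ trans_trans [2 *: x + _]addrC subrK !fZ; field.
pose phi x : R := f (trans O x) - f O.
have phi_lin : scalar phi by move=> t u w; rewrite /phi phiD fZ; ring.
pose phiL : {scalar V} :=
  HB.pack (phi : V -> R) (GRing.isLinear.Build _ _ _ _ phi phi_lin).
exists phiL => P x.
change (f (trans P x) = f P + (f (trans O x) - f O)).
by rewrite -(trans_vect O P) trans_trans phiD; ring.
Qed.

Lemma is_affine_quadratic f : is_affine f -> is_quadratic f.
Proof.
move=> fA P Q a b ab; rewrite /midpoint !(is_affine_bary _ _ fA) //; last by field.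
by have -> : b = 1 - a by [rewrite -ab addrC addKr]; field.
Qed.

Definition affine_pred : {pred A -> R^o} := [pred f | `[< is_affine f >]].

Lemma fct_linE (c : R) (f g : A -> R^o) P :
  (c *: f + g) P = c * f P + g P :> R.
Proof. by []. Qed.

Lemma affine_closed : submod_closed affine_pred.
Proof.
split=> [|c f g /asboolP fA /asboolP gA]; apply/asboolP.
  by apply: bary_affine => P Q a b _; change ((0 : R) = a * 0 + b * 0); ring.
apply: bary_affine => P Q a b ab; rewrite !fct_linE.
by rewrite (is_affine_bary _ _ fA ab) (is_affine_bary _ _ gA ab); ring.
Qed.
HB.instance Definition _ :=
  GRing.isSubmodClosed.Build R (A -> R^o) affine_pred affine_closed.

Definition quadratic_pred : {pred A -> R^o} := [pred f | `[< is_quadratic f >]].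

Lemma quadratic_closed : submod_closed quadratic_pred.
Proof.
split=> [|c f g /asboolP fE /asboolP gE]; apply/asboolP => P Q a b ab.
  by change ((0 : R) = a * (a - b) * 0 + b * (b - a) * 0 + 4 * a * b * 0); ring.
by rewrite !fct_linE fE // gE //; ring.
Qed.
HB.instance Definition _ :=
  GRing.isSubmodClosed.Build R (A -> R^o) quadratic_pred quadratic_closed.
End AffineTheory.
Arguments affine_pred {R V} A.
Arguments quadratic_pred {R V} A.

Section FunctionSpaces.
Variables (R : realType) (V : lmodType R) (A : affineType V).

Record aff := Aff { aff_fun :> A -> R^o; _ : aff_fun \in affine_pred A }.
HB.instance Definition _ := [isSub for aff_fun].
HB.instance Definition _ := [Choice of aff by <:].
HB.instance Definition _ := [SubChoice_isSubLmodule of aff by <:].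

Record quad := Quad { quad_fun :> A -> R^o; _ : quad_fun \in quadratic_pred A }.
HB.instance Definition _ := [isSub for quad_fun].
HB.instance Definition _ := [Choice of quad by <:].
HB.instance Definition _ := [SubChoice_isSubLmodule of quad by <:].

Lemma affP (f : aff) : is_affine f. Proof. by case: f => f /= /asboolP. Qed.

Lemma quadP (d : quad) : is_quadratic d.
Proof. by case: d => f /= /asboolP. Qed.

Lemma affD (f g : aff) P : (f + g) P = f P + g P. Proof. by []. Qed.
Lemma affB (f g : aff) P : (f - g) P = f P - g P. Proof. by []. Qed.
Lemma affZ (c : R) (f : aff) P : (c *: f) P = c * f P. Proof. by []. Qed.
Lemma quadD (d e : quad) P : (d + e) P = d P + e P. Proof. by []. Qed.
Lemma quadB (d e : quad) P : (d - e) P = d P - e P. Proof. by []. Qed.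
Lemma quadZ (c : R) (d : quad) P : (c *: d) P = c * d P. Proof. by []. Qed.

Definition MkAff f (fA : is_affine f) : aff := Aff (asboolT fA).
Definition MkQuad f (fQ : is_quadratic f) : quad := Quad (asboolT fQ).

Lemma aff_inj (f g : aff) : f =1 g -> f = g.
Proof. by move=> fg; apply/val_inj/funext. Qed.

Lemma quad_inj (d e : quad) : d =1 e -> d = e.
Proof. by move=> de; apply/val_inj/funext. Qed.

Lemma const_affine (c : R) : is_affine (fun _ : A => c : R^o).
Proof. by apply: bary_affine => P Q a b ab; rewrite -mulrDl ab mul1r. Qed.

(* the constant function $u$ *)
Definition aff_one : aff := MkAff (const_affine 1).

Definition aff_quad (f : aff) : quad := MkQuad (is_affine_quadratic (affP f)).

(* the linear part of [f]; it does not depend on the base point, see [dfunE] *)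
Definition dfun (f : aff) (x : V) : R := f (trans base_point x) - f base_point.

Lemma dfunE f P x : dfun f x = f (trans P x) - f P.
Proof. by rewrite /dfun; have [phi fE] := affP f; rewrite !fE; ring. Qed.

Definition affine_in_quad : {pred quad} :=
  [pred d | `[< is_affine (quad_fun d) >]].

Lemma affine_in_quad_closed : zmod_closed affine_in_quad.
Proof.
split=> [|d e /asboolP dA /asboolP eA]; apply/asboolP.
  by apply: bary_affine => P Q a b _; change ((0 : R) = a * 0 + b * 0); ring.
apply: bary_affine => P Q a b ab; rewrite !quadB.
by rewrite (is_affine_bary _ _ dA ab) (is_affine_bary _ _ eA ab); ring.
Qed.
HB.instance Definition _ :=
  GRing.isZmodClosed.Build quad affine_in_quad affine_in_quad_closed.

(* $\mathrm{Met}(A) = \mathrm{Quad}(A)/\mathrm{Aff}(A)$ *)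
Definition met := {ideal_quot affine_in_quad}.
HB.instance Definition _ := GRing.Zmodule.on met.

Definition met_of (d : quad) : met := (\pi_met d)%qT.

Lemma met_ofP (d e : quad) : reflect (is_affine (fun P => d P - e P)) (met_of d == met_of e).
Proof.
rewrite /met_of -Quotient.idealrBE; apply: (iffP (asboolP _)) => //.
Qed.

Lemma met_of_eq0 (d : quad) : reflect (is_affine d) (met_of d == 0).
Proof.
have -> : 0 = met_of 0 by rewrite /met_of raddf0.
apply: (iffP (met_ofP _ _)); congr is_affine; apply/funext => P.
  by change (d P - 0 = d P); rewrite subr0.
by change (d P = d P - 0); rewrite subr0.
Qed.

(* $z_P\in\widehat A=(\mathrm{Aff}(A))^*$ *)
Definition eval_at (P : A) : aff -> R := fun f => f P.

End FunctionSpaces.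

Arguments aff {R V} A.
Arguments quad {R V} A.
Arguments met {R V} A.
Arguments aff_one {R V} A.

Section QuadM.
Variables (R : realType) (V : lmodType R) (A : affineType V) (m : met A).

Record quadm := QuadM { quadm_quad :> quad A; quadmP : met_of quadm_quad = m }.

Lemma quadm_inj (d e : quadm) : d =1 e -> d = e.
Proof.
case: d e => [d dm] [e em] /= /quad_inj de; move: dm em; rewrite de => dm em.
by rewrite (Prop_irrelevance dm em).
Qed.

Lemma quadm_trans_subproof (d : quadm) (s : aff A) :
  met_of (quadm_quad d + aff_quad s) = m.
Proof.
rewrite -(quadmP d); apply/eqP/met_ofP.
have -> : (fun P => (quadm_quad d + aff_quad s) P - d P) = s; last exact: affP.
by apply/funext => P; rewrite quadD /=; ring.
Qed.

Lemma quadm_vect_subproof (d e : quadm) : is_affine (fun P => e P - d P).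
Proof. by apply/met_ofP; rewrite !quadmP. Qed.

Lemma quadm_base_subproof : met_of (repr m) = m.
Proof. exact: reprK. Qed.

Definition quadm_trans d s := QuadM (quadm_trans_subproof d s).
Definition quadm_vect d e : aff A := MkAff (quadm_vect_subproof d e).
Definition quadm_base := QuadM quadm_base_subproof.

Lemma quadm_transD d s t :
  quadm_trans (quadm_trans d s) t = quadm_trans d (s + t).
Proof.
apply: quadm_inj => P.
by change (d P + s P + t P = d P + (s P + t P)); rewrite addrA.
Qed.

Lemma quadm_trans_vect d e : quadm_trans d (quadm_vect d e) = e.
Proof. by apply: quadm_inj => P; change (d P + (e P - d P) = e P); rewrite subrKC. Qed.

Lemma quadm_vect_trans d s : quadm_vect d (quadm_trans d s) = s.
Proof. by apply: aff_inj => P; change (d P + s P - d P = s P); ring. Qed.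

HB.instance Definition _ := isAffineSpace.Build R (aff A) quadm
  quadm_base quadm_transD quadm_trans_vect quadm_vect_trans.
End QuadM.

Section Hessian.
Variables (R : realType) (V : lmodType R) (A : affineType V).
Implicit Types (d : A -> R^o) (P Q : A) (m : met A) (g : {symmetric V}).

(* $\delta^h_P(Q)$ *)
Definition hpart d P Q : R := 2^-1 * (d Q + d (reflect_pt P Q)) - d P.

Definition is_hess d g :=
  forall P Q, hpart d P Q = 2^-1 * g (vect P Q) (vect P Q).

Definition is_hess_met m g := forall d : quadm m, is_hess d g.

Lemma symC g x y : g x y = g y x.
Proof. by rewrite hermC /= expr0 mul1r. Qed.

Lemma sym_sqD g x y : g (x + y) (x + y) = g x x + 2 * g x y + g y y.
Proof. by rewrite linearDl /= !linearDr /= (symC g y x); ring. Qed.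

Lemma sym_sqZ g (a : R) x : g (a *: x) (a *: x) = a ^+ 2 * g x x.
Proof. by rewrite linearZl_LR /= linearZr_LR /=; ring. Qed.

Lemma sym_sqB g x y : g (x - y) (x - y) = g x x - 2 * g x y + g y y.
Proof.
by rewrite sym_sqD linearNr /= -[- y]scaleN1r sym_sqZ sqrrN expr1n mul1r mulrN.
Qed.

Lemma vectD P Q x : vect P (trans Q x) = vect P Q + x.
Proof. by rewrite -{1}(trans_vect P Q) trans_trans vect_trans. Qed.

Lemma vect_bary P Q Q' (a b : R) : a + b = 1 ->
  vect P (bary a b Q Q') = a *: vect P Q + b *: vect P Q'.
Proof.
move=> ab; rewrite /bary vectD -[in RHS](trans_vect Q Q') vectD scalerDr addrA.
by rewrite -scalerDl ab scale1r.
Qed.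

Lemma sqform_quadratic g P :
  is_quadratic (fun Q => 2^-1 * g (vect P Q) (vect P Q) : R^o).
Proof.
move=> Q Q' a b ab; rewrite /midpoint !vect_bary //; last by field.
by rewrite !sym_sqD !sym_sqZ !linearZl_LR /= !linearZr_LR /=; field.
Qed.

Lemma reflect_ptE P x : reflect_pt P (trans P x) = trans P (- x).
Proof. by rewrite /reflect_pt /bary vect_trans scaleN1r. Qed.

Lemma hpart_affine d P Q : is_affine d -> hpart d P Q = 0.
Proof.
move=> dA; rewrite /hpart /reflect_pt (is_affine_bary _ _ dA) //; first by field.
by rewrite -natr1 addrK.
Qed.

Lemma hpart0_affine d : is_quadratic d -> (forall P Q, hpart d P Q = 0) ->
  is_affine d.
Proof.
move=> dQ d0; apply: bary_affine => P Q a b ab; rewrite dQ //.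
have := d0 (midpoint P Q) P; rewrite /hpart.
have -> : reflect_pt (midpoint P Q) P = Q.
  rewrite /midpoint /bary; set x := vect P Q.
  rewrite -[X in reflect_pt _ X]trans0 -(subrr (2^-1 *: x)) -trans_trans.
  rewrite reflect_ptE opprK trans_trans -scalerDl -[RHS](trans_vect P) -/x.
  by have -> : 2^-1 + 2^-1 = 1 :> R; [field|rewrite scale1r].
move/eqP; rewrite subr_eq0 => /eqP <-.
by have -> : b = 1 - a; [rewrite -ab addrC addKr|field].
Qed.

Lemma sqform_hess g P :
  is_hess (fun Q => 2^-1 * g (vect P Q) (vect P Q) : R^o) g.
Proof.
move=> P' Q; move: (vect P' Q) (trans_vect P' Q) => x <-.
rewrite /hpart reflect_ptE !vectD.
by rewrite sym_sqB sym_sqD; field.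
Qed.

Lemma sqform_met m g P :
  is_hess_met m g -> met_of (MkQuad (sqform_quadratic g P)) = m.
Proof.
move=> gm; pose d : quadm m := base_point; rewrite -(quadmP d).
apply/eqP/met_ofP; set q := MkQuad _.
apply: (hpart0_affine (quadP (q - quadm_quad d))) => P' Q.
have -> : hpart (q - quadm_quad d) P' Q = hpart q P' Q - hpart d P' Q.
  by rewrite /hpart !quadB; ring.
by rewrite gm sqform_hess subrr.
Qed.

(* $\delta^m_P$, $g$ being the hessian principal component of $m$ *)
Definition delta_at m g (gm : is_hess_met m g) P : quadm m :=
  QuadM (sqform_met P gm).
End Hessian.

Section HessianExists.
Variables (R : realType) (V : lmodType R) (A : affineType V).
Variables (d : A -> R^o) (dQ : is_quadratic d).
Let O : A := base_point.

Definition line_quad (F : V -> R) := forall x y, exists b c : R,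
  forall t, F (x + t *: y) = F x + b * t + c * t ^+ 2.

Let dline P x : exists b c : R,
  forall t, d (trans P (t *: x)) = d P + b * t + c * t ^+ 2.
Proof.
pose M := d (midpoint P (trans P x)).
exists (4 * M - 3 * d P - d (trans P x)), (2 * d P + 2 * d (trans P x) - 4 * M).
move=> t; have := @dQ P (trans P x) (1 - t) t; rewrite subrK => /(_ erefl).
by rewrite {1}/bary vect_trans -/M => ->; ring.
Qed.

Let q x : R := 2^-1 * (d (trans O x) + d (trans O (- x))) - d O.
Let r x : R := 2^-1 * (d (trans O x) - d (trans O (- x))).

Let ql : line_quad q.
Proof.
move=> x y; have [b [c h]] := dline (trans O x) y.
have [b' [c' h']] := dline (trans O (- x)) (- y).
exists (2^-1 * (b + b')), (2^-1 * (c + c')) => t.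
have := h t; have := h' t; rewrite /q !trans_trans scalerN -opprD => -> ->.
by field.
Qed.

Let rl : line_quad r.
Proof.
move=> x y; have [b [c h]] := dline (trans O x) y.
have [b' [c' h']] := dline (trans O (- x)) (- y).
exists (2^-1 * (b - b')), (2^-1 * (c - c')) => t.
have := h t; have := h' t; rewrite /r !trans_trans scalerN -opprD => -> ->.
by field.
Qed.

Let qZ t x : q (t *: x) = t ^+ 2 * q x.
Proof.
have [b [c h]] := ql 0 x.
have q0 : q 0 = 0 by rewrite /q oppr0 trans0; field.
have h1 := h 1; have hm := h (-1); have := h t.
rewrite !add0r q0 !add0r ?scale1r ?scaleN1r in h1 hm *.
have qN : q (- x) = q x by rewrite /q opprK; ring.
rewrite qN in hm; have b0 : b = 0 by lra.
by rewrite b0 in h1 *; move=> ->; rewrite h1; ring.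
Qed.

Let rZ t x : r (t *: x) = t * r x.
Proof.
have [b [c h]] := rl 0 x.
have q0 : r 0 = 0 by rewrite /r oppr0 trans0; field.
have h1 := h 1; have hm := h (-1); have := h t.
rewrite !add0r q0 !add0r ?scale1r ?scaleN1r in h1 hm *.
have qN : r (- x) = - r x by rewrite /r opprK; ring.
have c0 : c = 0 by lra.
by rewrite c0 in h1 *; move=> ->; rewrite h1; ring.
Qed.

Let swap (t : R) (x y : V) : t != 0 -> x + t *: y = t *: (y + t^-1 *: x).
Proof. by move=> t0; rewrite scalerDr scalerA mulfV // scale1r addrC. Qed.

Let qline x y t :
  q (x + t *: y) = q x + (q (x + y) - q x - q y) * t + q y * t ^+ 2.
Proof.
have [b [c h]] := ql x y; have [b' [c' h']] := ql y x.
have e s : s != 0 -> q x + b * s + c * s ^+ 2 = q y * s ^+ 2 + b' * s + c'.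
  by move=> s0; rewrite -h swap // qZ h'; field.
have e1 := e 1 (oner_neq0 _).
have em := e (-1) (ltac:(by rewrite oppr_eq0 oner_neq0)).
have e2 := e 2 (ltac:(by rewrite pnatr_eq0)).
have h1 := h 1; rewrite scale1r in h1.
have cE : c = q y by lra.
by rewrite h h1 cE; ring.
Qed.

Let rmid x y : r (x + y) + r (x - y) = 2 * r x.
Proof.
have [b [c h]] := rl x y; have [b' [c' h']] := rl y x.
have e s : s != 0 -> r x + b * s + c * s ^+ 2 = r y * s + b' + c' * s^-1.
  by move=> s0; rewrite -h swap // rZ h'; field.
have e1 := e 1 (oner_neq0 _).
have em := e (-1) (ltac:(by rewrite oppr_eq0 oner_neq0)).
have e2 := e 2 (ltac:(by rewrite pnatr_eq0)).
have em2 := e (-2) (ltac:(by rewrite oppr_eq0 pnatr_eq0)).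
have h1 := h 1; rewrite scale1r in h1.
have hm := h (-1); rewrite scaleN1r in hm.
rewrite invr1 in e1; rewrite invrN invr1 in em; rewrite invrN in em2.
by rewrite h1 hm; lra.
Qed.

Let qpar x y : q (x + y) + q (x - y) = 2 * q x + 2 * q y.
Proof. by have := qline x y (-1); rewrite scaleN1r => ->; ring. Qed.

Let B x y : R := q (x + y) - q x - q y.

Let qN x : q (- x) = q x. Proof. by rewrite -scaleN1r qZ; ring. Qed.

Let BD x y z : B x (y + z) = B x y + B x z.
Proof.
have p1 := qpar (x + z) y; have p2 := qpar (y + z) x.
have p3 := qpar z (x - y); have p4 := qpar x y.
rewrite /B.
have e1 : x + z + y = x + (y + z) by rewrite addrAC addrA.
have e2 : y + z + x = x + (y + z) by rewrite addrC.
have e3 : x + z - y = z + (x - y) by rewrite [x + z]addrC addrA.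
have e4 : y + z - x = z - (x - y) by rewrite opprB [y + z]addrC addrA.
rewrite e1 e3 in p1; rewrite e2 e4 in p2; lra.
Qed.

Let BZ x y t : B x (t *: y) = t * B x y.
Proof. by rewrite /B qline qZ; ring. Qed.

Let BC x y : B x y = B y x. Proof. by rewrite /B [x + y]addrC; ring. Qed.

Lemma hess_exists : exists g : {symmetric V}, is_hess d g.
Proof.
have bB : bilinear_for (GRing.Scale.Law.clone _ _ *%R _)
    (GRing.Scale.Law.clone _ _ (idfun \; *%R) _) (B : V -> V -> R).
  split=> [u'|u] t x y.
    by rewrite ![B _ u']BC BD BZ.
  by rewrite BD BZ.
have hB x y : B x y = (-1) ^+ false * idfun (B y x).
  by rewrite expr0 mul1r /= BC.
pose g : {symmetric V} := HB.pack (B : V -> V -> R)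
  (bilinear_isBilinear.Build _ _ _ _ _ _ (B : V -> V -> R) bB)
  (isHermitianSesquilinear.Build _ _ _ _ (B : V -> V -> R) hB).
exists g => P Q; rewrite -[g _ _]/(B (vect P Q) (vect P Q)).
move: (vect P Q) (trans_vect P Q) => y <-; rewrite /hpart reflect_ptE.
have dE x : d (trans O x) = d O + q x + r x by rewrite /q /r; field.
move: (trans_vect O P) => <-; move: (vect O P) => x.
rewrite !trans_trans !dE /B.
have := qpar x y; have := rmid x y.
have -> : q (y + y) = 4 * q y by rewrite -mulr2n -scaler_nat qZ; ring.
by move=> *; lra.
Qed.
End HessianExists.

Section HessianUniqueness.
Variables (R : realType) (V : lmodType R).

Lemma sym_eq (g g' : {symmetric V}) : g =2 g' -> g = g'.
Proof.
move=> gg'; have {gg'} : g = g' :> (V -> V -> R).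
  by apply/funext => x; apply/funext => y; exact: gg'.
case: g g' => [f [[p1 p2 p3 p4] [p5]]] [f' [[q1 q2 q3 q4] [q5]]] /= ff'.
move: q1 q2 q3 q4 q5; rewrite -ff' => q1 q2 q3 q4 q5.
rewrite (Prop_irrelevance p1 q1) (Prop_irrelevance p2 q2).
rewrite (Prop_irrelevance p3 q3) (Prop_irrelevance p4 q4).
by rewrite (Prop_irrelevance p5 q5).
Qed.

Variable A : affineType V.

Lemma hess_unique (d : A -> R^o) (g g' : {symmetric V}) :
  is_hess d g -> is_hess d g' -> g = g'.
Proof.
move=> dg dg'; apply: sym_eq => x y; pose P : A := base_point.
have sq z : g z z = g' z z.
  have := dg P (trans P z); rewrite dg' vect_trans.
  by move=> /mulfI -> //; rewrite invr_eq0 pnatr_eq0.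
by have := sq (x + y); rewrite !sym_sqD (sq x) (sq y); lra.
Qed.

Lemma hess_met_exists (m : met A) : exists! g : {symmetric V}, is_hess_met m g.
Proof.
pose d : quadm m := base_point.
have [g dg] := hess_exists (quadP (quadm_quad d)).
exists g; split=> [e P Q|g' /(_ d) dg']; last exact: (hess_unique dg dg').
rewrite -dg; have := hpart_affine P Q (affP (vect d e)).
by rewrite /hpart /=; lra.
Qed.
End HessianUniqueness.

Section Functionals.
Variables (R : realType) (V : vectType R) (A : affineType V) (m : met A).

Lemma eval_affine P : is_affine (fun d : quadm m => d P : R^o).
Proof.
apply: bary_affine => d e a b ab.
change (d P + b * (e P - d P) = a * d P + b * e P).
by have -> : b = 1 - a; [rewrite -ab addrC addKr|ring].
Qed.

(* $v_P$ *)
Definition v_at P : aff (quadm m) := MkAff (eval_affine P).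

Definition v_m : aff (quadm m) := aff_one (quadm m).

(* $\mathrm d_m\bar v\in(\mathrm{Aff}(A))^*$ is the linear part of the affine
   functional $\bar v$ *)
Definition d_m (v : aff (quadm m)) : aff A -> R := dfun v.

Definition aff0 (v : aff (quadm m)) : Prop :=
  forall (d : quadm m) (a : R), v (trans d (a *: aff_one A)) = v d.

(* the embedding of $\vec A$ in $\widehat A = (\mathrm{Aff}(A))^*$ *)
Definition hat (x : V) : aff A -> R := fun f => dfun f x.

Lemma dfun_linear (f : aff A) : scalar (dfun f).
Proof.
have [phi fE] := affP f.
by move=> a x y; rewrite /dfun !fE linearP /=; ring.
Qed.

Lemma aff_sum I (r : seq I) (F : I -> aff A) P :
  (\sum_(i <- r) F i) P = \sum_(i <- r) F i P.
Proof. by elim/big_rec2: _ => [|i y z _ <-]. Qed.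

Lemma coord_affine (i : 'I_(\dim {:V})) :
  is_affine (fun Q : A => coord (vbasis {:V}) i (vect base_point Q) : R^o).
Proof. by apply: bary_affine => P Q a b ab; rewrite vect_bary // linearP linearZ. Qed.

Lemma aff_coord (f : aff A) : f = f base_point *: aff_one A +
  \sum_(i < \dim {:V}) dfun f (vbasis {:V})`_i *: MkAff (coord_affine i).
Proof.
pose df : {scalar V} :=
  HB.pack (dfun f : V -> R) (GRing.isLinear.Build _ _ _ _ (dfun f) (dfun_linear f)).
apply: aff_inj => P; rewrite affD affZ aff_sum mulr1.
rewrite -[in LHS](trans_vect base_point P) -[LHS](subrK (f base_point)) -dfunE.
rewrite addrC; congr (_ + _).
rewrite [in LHS](coord_vbasis (memvf (vect base_point P))).
rewrite -[dfun f]/(df : V -> R) linear_sum; apply: eq_bigr => i _.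
by rewrite linearZ affZ mulrC.
Qed.

Lemma hat_surj (z : {scalar aff A}) : z (aff_one A) = 0 ->
  exists x, hat x = z.
Proof.
move=> z1; exists (\sum_(i < \dim {:V}) z (MkAff (coord_affine i)) *: (vbasis {:V})`_i).
apply/funext => f; rewrite /hat [in RHS](aff_coord f) linearD linearZ /= z1 mulr0 add0r.
pose df : {scalar V} :=
  HB.pack (dfun f : V -> R) (GRing.isLinear.Build _ _ _ _ (dfun f) (dfun_linear f)).
rewrite -[dfun f]/(df : V -> R) !linear_sum; apply: eq_bigr => i _.
rewrite !linearZ. exact: mulrC.
Qed.

Lemma hat_inj : injective hat.
Proof.
move=> x y xy; rewrite (coord_vbasis (memvf x)) (coord_vbasis (memvf y)).
apply: eq_bigr => i _; congr (_ *: _).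
have := congr1 (@^~ (MkAff (coord_affine i))) xy; rewrite /hat.
by rewrite !(dfunE _ base_point) /= !vect_trans => /addIr.
Qed.

(* the inverse of $\vec A\simeq\{z\in\widehat A : \langle z,u\rangle=0\}$, see
   [hatK] and [dvecK] *)
Definition unhat (z : aff A -> R) : V := xget 0 [set x | hat x = z]%classic.

Lemma hatK : cancel hat unhat.
Proof. by move=> x; apply: xget_unique => // y /hat_inj. Qed.

Definition dvec (v : aff (quadm m)) : V := unhat (d_m v).

Lemma dvecK v : aff0 v -> hat (dvec v) = d_m v.
Proof.
move=> v0; have [phi vE] := affP v.
have dv : d_m v = phi by apply/funext => s; rewrite /d_m /dfun vE addrC addKr.
rewrite /dvec dv; apply: (@xgetPex _ _ [set x | hat x = phi]%classic).
apply: hat_surj; have := v0 base_point 1; rewrite scale1r vE => /eqP.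
by rewrite -subr_eq0 addrC addKr => /eqP.
Qed.

End Functionals.

Section Referential.
Variables (R : realType) (V : vectType R) (A : affineType V).

Definition affine_referential (r : 'I_(\dim {:V}).+1 -> A) : bool :=
  free [seq vect (r ord0) (r (lift ord0 i)) | i : 'I_(\dim {:V})].
End Referential.

(* Main.v *)
Require Import Defs.
From HB Require Import structures.
From mathcomp Require Import all_boot all_order all_algebra.
From mathcomp Require Import boolp classical_sets functions reals.
From mathcomp Require Import ring lra.

Set Implicit Arguments.
Unset Strict Implicit.
Unset Printing Implicit Defensive.

Import Order.TTheory GRing.Theory Num.Theory.
Local Open Scope ring_scope.

(** Write W for the space of affine functionals on the class m, and fix a point
    P. A functional v has a weight, the value of d_m v on the constant function
    1; a functional has weight 0 exactly when it lies in Aff_0, and every v_P has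
    weight 1, so that W is the direct sum of the line of v_P and of Aff_0. A form
    CM that is prescribed on Aff_0, as - g, is therefore determined by its row at
    v_P ([eq_form_of_v_at]), and everything reduces to showing that each of the
    equivalent conditions forces this row to be evaluation at delta_P.

    Since v_Q - v_P lies in Aff_0 with direction PQ, the value of CM on it gives
    the polarization identity
      2 CM(v_P, v_Q) = CM(v_P, v_P) + CM(v_Q, v_Q) + g(PQ, PQ)
    ([pairing_v_at]). When all points are isotropic, CM(v_P, v_Q) is thus
    delta_P(Q), the value of v_Q at delta_P; conversely, when the row at one P is
    evaluation at delta_P, the identity makes every v_Q isotropic
    ([delta_isotropic]).

    Agreement on the functionals v_Q is enough provided that they span W. The
    kernel of d_m is the line of v_m, so a functional is, up to a multiple of
    v_m, a combination of v_P and of differences v_Q - v_P ([scalar_eq0_span]).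
    The functional v_m is itself a combination of v_Q's because the metric is not
    null: v_{P+x} + v_{P-x} - 2 v_P = g(x, x) v_m, and g(x, x) is nonzero for some
    x ([v_m_second_difference], [scalar_v_at_eq0]). With only the points of a
    referential at hand, v_m cannot be recovered in this way, whence the
    normalization CM(v_{R_0}, v_m) = 1 ([referential_delta]).

    For existence, the decomposition of W dictates the formula
      CM(v, w) = a(v) w(delta_P) + a(w) v(delta_P) - g(t(v), t(w)),
    with a(v) the weight of v and t(v) the vector that represents the Aff_0
    component v - a(v) v_P ([cayley_menger_exists]). *)

(** * Vectors in the linear hull, and affine referentials *)

Section LinearHull.
Variables (R : realType) (V : vectType R) (A : affineType V).

Lemma hat_linear a (x y : V) (s : aff A) :
  hat (a *: x + y) s = a * hat x s + hat y s.
Proof. exact: dfun_linear. Qed.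

Lemma hat_vect (P Q : A) (s : aff A) : hat (vect P Q) s = s Q - s P.
Proof. by rewrite /hat (dfunE s P) trans_vect. Qed.

Lemma affine_referential_exists :
  exists r : 'I_(\dim {:V}).+1 -> A, affine_referential r.
Proof.
pose O : A := base_point.
exists (fun j => if unlift ord0 j is Some i then trans O (vbasis {:V})`_i else O).
rewrite /affine_referential.
set s := [seq _ | _ : _].
suff -> : s = vbasis {:V} by exact: basis_free (vbasisP _).
apply: (@eq_from_nth _ 0); first by rewrite size_map size_enum_ord size_tuple.
move=> k; rewrite size_map size_enum_ord => lt_k.
rewrite (nth_map (Ordinal lt_k)) ?size_enum_ord //.
by rewrite unlift_none liftK vect_trans nth_enum_ord.
Qed.

Lemma referential_span (r : 'I_(\dim {:V}).+1 -> A) (x : V) :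
  affine_referential r ->
  exists c : 'I_(\dim {:V}) -> R,
    x = \sum_i c i *: vect (r ord0) (r (lift ord0 i)).
Proof.
rewrite /affine_referential; set s := [seq _ | _ : _] => free_s.
have size_s : size s == \dim {:V} by rewrite size_map size_enum_ord.
pose X := Tuple size_s.
have bX : basis_of {:V} X.
  by rewrite basisEfree free_s subvf /= (eqP size_s).
exists (fun i => coord X i x).
rewrite [LHS](coord_basis bX (memvf x)); apply: eq_bigr => i _.
by rewrite /= (nth_map i) ?size_enum_ord // nth_ord_enum.
Qed.
End LinearHull.

(** * Affine functionals on the class of a metric *)

Section Functionals.
Variables (R : realType) (V : vectType R) (A : affineType V) (m : met A).
Implicit Types (P Q : A) (v w : aff (quadm m)) (d : quadm m) (s : aff A).

Lemma quadm_transE v d s : v (trans d s) = v d + d_m v s.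
Proof. by rewrite /d_m (dfunE v d) addrC subrK. Qed.

Lemma d_mD v w s : d_m (v + w) s = d_m v s + d_m w s.
Proof. by rewrite /d_m /dfun !affD; ring. Qed.

Lemma d_mB v w s : d_m (v - w) s = d_m v s - d_m w s.
Proof. by rewrite /d_m /dfun !affB; ring. Qed.

Lemma d_mZ a v s : d_m (a *: v) s = a * d_m v s.
Proof. by rewrite /d_m /dfun !affZ; ring. Qed.

Lemma d_m_sum I (r : seq I) (F : I -> aff (quadm m)) s :
  d_m (\sum_(i <- r) F i) s = \sum_(i <- r) d_m (F i) s.
Proof.
elim/big_rec2: _ => [|i y w _ <-]; first exact: subrr.
by rewrite d_mD.
Qed.

Lemma d_m_v_at P s : d_m (v_at m P) s = s P.
Proof.
pose d : quadm m := base_point.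
have : d P + s P = d P + d_m (v_at m P) s := quadm_transE (v_at m P) d s.
by move=> /addrI ->.
Qed.

(** The translations by constants have direction R 1, and d_m v is linear. *)
Lemma aff0P v : aff0 v <-> d_m v (aff_one A) = 0.
Proof.
split=> [v0|v0 d a].
  have := v0 base_point 1; rewrite scale1r quadm_transE => /eqP.
  by rewrite -subr_eq0 addrC addKr => /eqP.
have [phi dE] : exists phi : {scalar aff A}, d_m v =1 phi.
  have [phi vE] := affP v; exists phi => s.
  by rewrite /d_m /dfun vE addrC addKr.
by rewrite quadm_transE dE linearZ /= -dE v0 mulr0 addr0.
Qed.

(** Quad_m A is a single orbit of Aff(A): a functional without linear part is
    constant. *)
Lemma d_m_eq0 v : (forall s, d_m v s = 0) -> v = v base_point *: v_m m.
Proof.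
move=> v0; apply: aff_inj => d; rewrite affZ mulr1.
by rewrite -[in LHS](trans_vect base_point d) quadm_transE v0 addr0.
Qed.

(** A combination of points sum c_i v_{P_i} has weight sum c_i. *)
Definition weight v : R := d_m v (aff_one A).

Lemma weight_linear a v w : weight (a *: v + w) = a * weight v + weight w.
Proof. by rewrite /weight d_mD d_mZ. Qed.

Lemma weight_v_at P : weight (v_at m P) = 1.
Proof. exact: d_m_v_at. Qed.

Lemma aff0_sub_weight P v : aff0 (v - weight v *: v_at m P).
Proof. by apply/aff0P; rewrite d_mB d_mZ d_m_v_at mulr1 subrr. Qed.

Lemma dir_subproof P : {f : aff (quadm m) -> V |
  forall v s, hat (f v) s = d_m v s - weight v * s P}.
Proof.
exists (fun v => dvec (v - weight v *: v_at m P)) => v s.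
by rewrite dvecK ?d_mB ?d_mZ ?d_m_v_at //; exact: aff0_sub_weight.
Qed.

(** The vector of the Aff_0 component of v in the decomposition of the functionals
    along v_P. It is extracted from an opaque proof, so that unification compares
    two such vectors without unfolding the choice that underlies [unhat]. *)
Definition dir P : aff (quadm m) -> V := sval (dir_subproof P).

Lemma dirE P v s : hat (dir P v) s = d_m v s - weight v * s P.
Proof. exact: (svalP (dir_subproof P)). Qed.

Lemma dir_linear P a v w : dir P (a *: v + w) = a *: dir P v + dir P w.
Proof.
apply: (@hat_inj _ _ A); apply/funext => s.
rewrite hat_linear [LHS]dirE weight_linear d_mD d_mZ.
by rewrite !dirE; ring.
Qed.

Lemma dir_v_at P Q : dir P (v_at m Q) = vect P Q.
Proof.
apply: (@hat_inj _ _ A); apply/funext => s.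
by rewrite dirE weight_v_at hat_vect !d_m_v_at mul1r.
Qed.

Lemma dir_aff0 P v : aff0 v -> dir P v = dvec v.
Proof.
move=> v0; apply: (@hat_inj _ _ A); apply/funext => s.
by rewrite dirE dvecK // /weight (aff0P v).1 // mul0r subr0.
Qed.

Lemma aff0_subv P Q : aff0 (v_at m Q - v_at m P).
Proof. by apply/aff0P; rewrite d_mB !d_m_v_at subrr. Qed.

Lemma dvec_subv P Q : dvec (v_at m Q - v_at m P) = vect P Q.
Proof.
apply: (@hat_inj _ _ A); rewrite dvecK; last exact: aff0_subv.
by apply/funext => s; rewrite hat_vect d_mB !d_m_v_at.
Qed.

(** The hypothesis on the direction makes v a combination of v_P, v_m and the
    v_{Q i}: the functional u below has the weight and the direction of v, hence
    its linear part, so v - u is constant. *)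
Lemma scalar_eq0_span (F : aff (quadm m) -> R) P (T : finType) (Q : T -> A)
    (c : T -> R) v : scalar F ->
  dir P v = \sum_i c i *: vect P (Q i) ->
  F (v_m m) = 0 -> F (v_at m P) = 0 -> (forall i, F (v_at m (Q i)) = 0) ->
  F v = 0.
Proof.
move=> F_lin vE Fm FP FQ.
pose f : {scalar aff (quadm m)} :=
  HB.pack F (GRing.isLinear.Build _ _ _ _ F F_lin).
pose u := weight v *: v_at m P + \sum_i c i *: (v_at m (Q i) - v_at m P).
have /d_m_eq0 : forall s, d_m (v - u) s = 0.
  move=> s; rewrite d_mB d_mD d_mZ d_m_v_at d_m_sum.
  have -> : \sum_i d_m (c i *: (v_at m (Q i) - v_at m P)) s = hat (dir P v) s.
    pose h : {scalar V} := HB.pack (dfun s : V -> R)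
      (GRing.isLinear.Build _ _ _ _ (dfun s) (dfun_linear s)).
    rewrite vE -[RHS]/(h _) linear_sum; apply: eq_bigr => i _.
    by rewrite linearZ -[h _]/(hat _ _) hat_vect d_mZ d_mB !d_m_v_at.
  by rewrite dirE; ring.
move: ((v - u) base_point) => k /(canRL (subrK _)) ->.
rewrite -[F _]/(f _) linearD linearZ /= Fm mulr0 add0r.
rewrite -[F _]/(f _) linearD linearZ /= FP mulr0 add0r.
rewrite -[F _]/(f _) linear_sum big1 // => i _.
by rewrite -[LHS]/(f _) linearZ linearB /= FP FQ subrr mulr0.
Qed.
End Functionals.

(** * Symmetric forms extending the opposite of the hessian *)

Section Forms.
Variables (R : realType) (V : vectType R) (A : affineType V) (m : met A).
Variables (g : {symmetric V}) (gm : is_hess_met m g).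
Implicit Types (P Q : A) (v w : aff (quadm m)) (d : quadm m).
Implicit Types CM : {symmetric aff (quadm m)}.

Lemma delta_at_diag P : delta_at gm P P = 0.
Proof.
have -> : delta_at gm P P = 2^-1 * g (vect P P) (vect P P) by [].
by rewrite -{2 4}[P]trans0 vect_trans linear0r mulr0.
Qed.

(** A quadratic function with vanishing hessian is affine. *)
Lemma hess_sq_neq0 : m != 0 -> exists x, g x x != 0.
Proof.
move=> m0; apply: contrapT => g0; move/negP: m0; apply.
pose d : quadm m := base_point; rewrite -(quadmP d); apply/met_of_eq0.
apply: hpart0_affine (quadP _) _ => P Q; rewrite (gm d).
case: (eqVneq (g (vect P Q) (vect P Q)) 0) => [->|gx]; first by rewrite mulr0.
by case: g0; exists (vect P Q).
Qed.

(** All the elements of the class m have the same second differences, those of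
    the hessian g. *)
Lemma v_m_second_difference P x :
  v_at m (trans P x) + v_at m (trans P (- x)) - 2 *: v_at m P = g x x *: v_m m.
Proof.
apply: aff_inj => d; rewrite affB affD !affZ mulr1.
have := gm d P (trans P x); rewrite /hpart reflect_ptE vect_trans.
by rewrite /v_at /=; lra.
Qed.

(** The v_Q span all functionals: the points P and P + x reach every direction x,
    and v_m is obtained from a second difference along a vector that is not
    isotropic for g. *)
Lemma scalar_v_at_eq0 (F : aff (quadm m) -> R) : m != 0 -> scalar F ->
  (forall P, F (v_at m P) = 0) -> forall v, F v = 0.
Proof.
move=> m0 F_lin F0 v; pose P : A := base_point.
apply: (@scalar_eq0_span _ _ _ _ F P unit
  (fun=> trans P (dir P v)) (fun=> 1)) => //.
  by rewrite big_const card_unit /= addr0 scale1r vect_trans.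
have [x gx] := hess_sq_neq0 m0.
pose f : {scalar aff (quadm m)} :=
  HB.pack F (GRing.isLinear.Build _ _ _ _ F F_lin).
have := congr1 f (v_m_second_difference P x).
rewrite linearB linearD !linearZ /= !F0 mulr0 addr0 subr0.
by move/esym/eqP; rewrite mulf_eq0 (negPf gx) => /eqP.
Qed.

Definition opp_hess_on_aff0 CM := forall v1 v2 : aff (quadm m),
  aff0 v1 -> aff0 v2 -> CM v1 v2 = - g (dvec v1) (dvec v2).

Definition isotropic_points CM := forall P, CM (v_at m P) (v_at m P) = 0.

(** Polarization on v_Q - v_P, which lies in Aff_0 with direction PQ. *)
Lemma pairing_v_at CM P Q : opp_hess_on_aff0 CM ->
  2 * CM (v_at m P) (v_at m Q) =
  CM (v_at m P) (v_at m P) + CM (v_at m Q) (v_at m Q)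
  + g (vect P Q) (vect P Q).
Proof.
move=> CMg; have := CMg _ _ (@aff0_subv _ _ _ m P Q) (@aff0_subv _ _ _ m P Q).
by rewrite sym_sqB dvec_subv (symC CM (v_at m Q) (v_at m P)); lra.
Qed.

Lemma defect_linear CM v d : scalar (fun w => CM v w - w d).
Proof.
by move=> a w w'; rewrite affD affZ linearDr linearZr_LR /=; ring.
Qed.

(** By polarization, both functionals take the value g(PQ, PQ) / 2 at v_Q. *)
Lemma isotropic_delta CM P :
  m != 0 -> opp_hess_on_aff0 CM -> isotropic_points CM ->
  CM (v_at m P) = eval_at (delta_at gm P).
Proof.
move=> m0 CMg CM0; apply/funext => w; apply/eqP; rewrite -subr_eq0; apply/eqP.
apply: (scalar_v_at_eq0 m0 (defect_linear CM _ _)) => Q.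
have := pairing_v_at P Q CMg; rewrite !CM0.
change (v_at m Q (delta_at gm P)) with (2^-1 * g (vect P Q) (vect P Q)).
by lra.
Qed.

(** A single point P is enough: in the polarization identity the row at v_P gives
    2 CM(v_P, v_Q) = g(PQ, PQ), which leaves nothing for CM(v_Q, v_Q). *)
Lemma delta_isotropic CM P : opp_hess_on_aff0 CM ->
  CM (v_at m P) = eval_at (delta_at gm P) -> isotropic_points CM.
Proof.
move=> CMg CMP Q; have := pairing_v_at P Q CMg; rewrite CMP.
change (2 * (2^-1 * g (vect P Q) (vect P Q)) =
  delta_at gm P P + CM (v_at m Q) (v_at m Q) + g (vect P Q) (vect P Q) ->
  CM (v_at m Q) (v_at m Q) = 0).
by rewrite delta_at_diag; lra.
Qed.

(** The functionals v_{R_i} and v_m span all of them, and on each of them the row at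
    v_{R_0} is evaluation at delta_{R_0}: on v_{R_i} by polarization, on v_m by the
    normalization. *)
Lemma referential_delta CM (r : 'I_(\dim {:V}).+1 -> A) : opp_hess_on_aff0 CM ->
  affine_referential r ->
  (forall i, CM (v_at m (r i)) (v_at m (r i)) = 0) ->
  CM (v_at m (r ord0)) (v_m m) = 1 ->
  CM (v_at m (r ord0)) = eval_at (delta_at gm (r ord0)).
Proof.
move=> CMg r_ref CM0 CM1; apply/funext => w.
apply/eqP; rewrite -subr_eq0; apply/eqP.
have [c cE] := referential_span (dir (r ord0) w) r_ref.
have F0 i : CM (v_at m (r ord0)) (v_at m (r i))
            - v_at m (r i) (delta_at gm (r ord0)) = 0.
  have := pairing_v_at (r ord0) (r i) CMg; rewrite !CM0.
  set x := vect _ _.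
  change (v_at m (r i) (delta_at gm (r ord0))) with (2^-1 * g x x).
  by lra.
apply: (scalar_eq0_span (defect_linear CM _ _) cE) => //.
by rewrite CM1; exact: subrr.
Qed.

(** The functionals are spanned by v_P and Aff_0, where both forms are - g. *)
Lemma eq_form_of_v_at CM CM' P : opp_hess_on_aff0 CM -> opp_hess_on_aff0 CM' ->
  CM (v_at m P) =1 CM' (v_at m P) -> CM = CM'.
Proof.
move=> CMg CMg' CMP; apply: sym_eq => v w.
have dec u : exists a u0, aff0 u0 /\ u = a *: v_at m P + u0.
  exists (weight u), (u - weight u *: v_at m P).
  by split; [exact: aff0_sub_weight|rewrite subrKC].
have [a [v0 [v00 ->]]] := dec v; have [b [w0 [w00 ->]]] := dec w.
rewrite !linearDl /= !linearZl_LR /= CMP !linearDr /= !linearZr_LR /=.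
rewrite (symC CM v0 (v_at m P)) (symC CM' v0 (v_at m P)) CMP.
by rewrite (CMg _ _ v00 w00) (CMg' _ _ v00 w00).
Qed.

(** The form dictated by the decomposition along v_P: it pairs v_P with itself to
    delta_P(P) = 0, and v_P with w to w(delta_P). For another point Q the two mixed
    terms add up to g(PQ, PQ), which the last term cancels. *)
Lemma cayley_menger_exists :
  exists CM, opp_hess_on_aff0 CM /\ isotropic_points CM.
Proof.
pose P : A := base_point; pose D := delta_at gm P.
pose B v w : R :=
  weight v * w D + weight w * v D - g (dir P v) (dir P w).
have BC v w : B v w = B w v by rewrite /B (symC g (dir P w)); ring.
have B_linear v a w w' : B v (a *: w + w') = a * B v w + B v w'.
  rewrite /B dir_linear weight_linear affD affZ linearDr linearZr_LR /=.
  by ring.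
have bB : bilinear_for (GRing.Scale.Law.clone _ _ *%R _)
    (GRing.Scale.Law.clone _ _ (idfun \; *%R) _)
    (B : aff (quadm m) -> aff (quadm m) -> R).
  split=> [w|v] a x y; last exact: B_linear.
  by rewrite ![B _ w]BC B_linear.
have hB v w : B v w = (-1) ^+ false * idfun (B w v).
  by rewrite expr0 mul1r /= BC.
pose CM : {symmetric aff (quadm m)} := HB.pack
  (B : aff (quadm m) -> aff (quadm m) -> R)
  (bilinear_isBilinear.Build _ _ _ _ _ _ _ bB)
  (isHermitianSesquilinear.Build _ _ _ _ _ hB).
exists CM; split=> [v w v0 w0|Q].
  rewrite -[CM v w]/(B v w) /B !dir_aff0 // /weight.
  by rewrite (aff0P v).1 // (aff0P w).1 // !mul0r !add0r.
rewrite -[CM _ _]/(B _ _) /B weight_v_at dir_v_at !mul1r.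
change (v_at m Q D) with (2^-1 * g (vect P Q) (vect P Q)).
by field.
Qed.
End Forms.

Theorem theorem5p11 (R : realType) (V : vectType R) (A : affineType V)
    (m : met A) (g : {symmetric V}) (m_neq0 : m != 0) (gm : is_hess_met m g) :
  let cond1 (CM : {symmetric aff (quadm m)}) :=
    forall v1 v2 : aff (quadm m), aff0 v1 -> aff0 v2 ->
      CM v1 v2 = - g (dvec v1) (dvec v2) in
  let cond2 (CM : {symmetric aff (quadm m)}) :=
    forall P : A, CM (v_at m P) (v_at m P) = 0 in
  (exists! CM : {symmetric aff (quadm m)}, cond1 CM /\ cond2 CM) /\
  (forall CM : {symmetric aff (quadm m)}, cond1 CM ->
    [/\ cond2 CM <->
          (forall P : A, CM (v_at m P) = eval_at (delta_at gm P)),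
        cond2 CM <->
          (exists P : A, CM (v_at m P) = eval_at (delta_at gm P)),
        cond2 CM <->
          (forall r : 'I_(\dim {:V}).+1 -> A, affine_referential r ->
             forall i, CM (v_at m (r i)) (v_at m (r i)) = 0 /\
                       CM (v_at m (r i)) (v_m m) = 1) &
        cond2 CM <->
          (exists r : 'I_(\dim {:V}).+1 -> A,
             [/\ affine_referential r,
                 forall i, CM (v_at m (r i)) (v_at m (r i)) = 0 &
                 CM (v_at m (r ord0)) (v_m m) = 1])]).
Proof.
move=> cond1 cond2; split=> [|CM CM1].
  have [CM [CM1 CM2]] := cayley_menger_exists gm.
  exists CM; split=> // CM' [CM1' CM2'].
  apply: (eq_form_of_v_at (P := base_point) CM1 CM1') => v.
  rewrite (isotropic_delta gm _ m_neq0 CM1) //.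
  by rewrite (isotropic_delta gm _ m_neq0 CM1').
have delta := fun P => isotropic_delta gm P m_neq0 CM1.
have iso P := @delta_isotropic _ _ _ _ _ gm CM P CM1.
have [r0 r0_ref] := affine_referential_exists A.
have dm P : cond2 CM -> CM (v_at m P) (v_m m) = 1 by move=> /delta ->.
have ref r := @referential_delta _ _ _ _ _ gm CM r CM1.
split; split.
- by move=> CM2 P; exact: delta.
- by move=> /(_ base_point)/iso.
- by move=> CM2; exists base_point; exact: delta.
- by move=> [P /iso].
- by move=> CM2 r _ i; split; [exact: CM2|exact: dm].
- move=> /(_ r0 r0_ref) r0P; apply: (iso (r0 ord0)); apply: ref => //.
    by move=> i; case: (r0P i).
  by case: (r0P ord0).
- by move=> CM2; exists r0; split=> [||]; [|move=> i; exact: CM2|exact: dm].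
- by move=> [r [r_ref r_iso rm]]; apply: (iso (r ord0)); exact: ref.
Qed.
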